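(* Let $P\in\mathbb{N}$ and let $\Phi$ be a Poisson point process on $[0,P]$ (the set of transmit powers $p_{0j}$, all satisfying $p_{0j}\le P$, from a typical base station to its served mobile terminals) with cumulative intensity $\Lambda$, i.e. $\Lambda(p)<\infty$ is the expected number of points of $\Phi$ in $[0,p]$, with $\Lambda(0)=0$. For $m\in\mathbb{N}_0$ put $$\mathbb{P}_{\Sigma}(m,\Lambda,P)=\mathbb{P}\Big(\sum_{p_{0j}\in\Phi}\lceil p_{0j}\rceil=m\Big).$$ Then $$\mathbb{P}_{\Sigma}(0,\Lambda,P)=\exp(-\Lambda(P)),$$ and for every integer $m\ge 1$ $$\mathbb{P}_{\Sigma}(m,\Lambda,P)=\sum_{q=1}^{m^\star}\frac{q}{m}\,C_q\,\mathbb{P}_{\Sigma}(m-q,\Lambda,P),$$ where $C_q=\Lambda(q)-\Lambda(q-1)$ and $m^\star=\min(m,P)$.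
   Context: $\lceil x\rceil$ is the ceiling of $x$ (powers are measured in battery power units and rounded up to the nearest unit). The empty sum is $0$. The ''density $\Lambda(p)$'' of a point process on $\mathbb{R}^+$ is understood cumulatively: $\Lambda(p)$ is the mean number of points in $[0,p]$. *)

(* Defs.v *)
From HB Require Import structures.
From mathcomp Require Import all_boot all_order all_algebra.
From mathcomp Require Import all_classical all_reals all_analysis.

Set Implicit Arguments.
Unset Strict Implicit.
Unset Printing Implicit Defensive.

Import Order.TTheory GRing.Theory Num.Theory.
Import numFieldNormedType.Exports.

Local Open Scope classical_set_scope.
Local Open Scope ring_scope.

(* A finite point configuration is represented by a sequence, as a multiset:
   a sequence stands for its points counted with multiplicity, and nothing
   below depends on the order in which they are listed.  A sequence can have
   repeated points because the intensity measure may have atoms. *)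
Definition npoints {R : realType} {T : Type} (Phi : T -> seq R) (B : set R)
    (w : T) : nat :=
  count (fun p => p \in B) (Phi w).

Definition point_process {d : measure_display} {T : measurableType d}
    {R : realType} (E : set R) (Phi : T -> seq R) : Prop :=
  (forall w p, p \in Phi w -> E p) /\
  (forall B : set R, measurable B -> measurable_fun setT (npoints Phi B)).

(* Every subset of nat is measurable.  Independence of the subfamilies is
   included, by taking A i = setT for the omitted indices. *)
Definition mutually_independent {d : measure_display} {T : measurableType d}
    {R : realType} (Pr : probability T R) (n : nat) (X : 'I_n -> T -> nat)
    : Prop :=
  forall A : 'I_n -> set nat,
    (Pr (\bigcap_(i in [set: 'I_n]) (X i @^-1` A i))
     = \prod_(i < n) Pr (X i @^-1` A i))%E.

(* The finiteness of mu E is the local finiteness of the intensity measure when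
   E is compact.  The second argument of poisson_prob is a dummy;
   poisson_prob 0 is the Dirac mass at 0. *)
Definition poisson_process {d : measure_display} {T : measurableType d}
    {R : realType} (Pr : probability T R) (E : set R)
    (mu : {measure set (measurableTypeR R) -> \bar R}) (Phi : T -> seq R) : Prop :=
  [/\ point_process E Phi,
      (mu E < +oo)%E,
      forall B : set R, measurable B -> B `<=` E ->
        forall A : set nat,
          Pr (npoints Phi B @^-1` A) = poisson_prob (fine (mu B)) 0 A
    & forall (n : nat) (B : 'I_n -> set R),
        (forall i, measurable (B i)) -> (forall i, B i `<=` E) ->
        trivIset setT B ->
        mutually_independent Pr (fun i => npoints Phi (B i))].

Definition mean_npoints {d : measure_display} {T : measurableType d}
    {R : realType} (Pr : probability T R) (Phi : T -> seq R) (B : set R)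
    : \bar R :=
  ('E_Pr[fun w => (npoints Phi B w)%:R])%E.

Definition total_power_prob {d : measure_display} {T : measurableType d}
    {R : realType} (Pr : probability T R) (Phi : T -> seq R) (m : nat)
    : \bar R :=
  Pr [set w | \sum_(p <- Phi w) Num.ceil p = m%:Z].

(* Main.v *)
(* The numbers N_q of points in ]q - 1, q], 1 <= q <= P, are independent Poisson
   variables with means C_q, and the total power is S = \sum_q q N_q.  The
   Poisson weights satisfy (k + 1) w(k + 1) = C_q w(k), so removing one point
   from ]q - 1, q] gives E[N_q; S = m] = C_q Pr(S = m - q).  Summing q times
   this identity over q gives m Pr(S = m) = \sum_q q C_q Pr(S = m - q). *)
Require Import Defs.
From HB Require Import structures.
From mathcomp Require Import all_boot all_order all_algebra.
From mathcomp Require Import all_classical all_reals all_analysis.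
From mathcomp Require Import measurable_realfun.
From mathcomp Require Import zify ring.

Set Implicit Arguments.
Unset Strict Implicit.
Unset Printing Implicit Defensive.

Import Order.TTheory GRing.Theory Num.Theory.
Import numFieldNormedType.Exports.

Local Open Scope classical_set_scope.
Local Open Scope ring_scope.

(** * Weighted sums over bounded count vectors *)

(* In [f], the value [f i] counts the points in ]i, i + 1]; the bound [M] only
   serves to make the set of such [f] finite. *)
Definition weighted_size (P M : nat) (f : {ffun 'I_P -> 'I_M.+1}) : nat :=
  (\sum_(i < P) i.+1 * f i)%N.

Definition prod_pmf (R : nzRingType) (P M : nat) (w : 'I_P -> nat -> R)
    (f : {ffun 'I_P -> 'I_M.+1}) : R := \prod_(i < P) w i (f i).

Lemma weighted_size_ge (P M : nat) (f : {ffun 'I_P -> 'I_M.+1}) (i : 'I_P) :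
  (i.+1 * f i <= weighted_size f)%N.
Proof. by rewrite /weighted_size (bigD1 i)//= leq_addr. Qed.

Definition set_coord (P M : nat) (i : 'I_P) (k : 'I_M.+1)
    (f : {ffun 'I_P -> 'I_M.+1}) : {ffun 'I_P -> 'I_M.+1} :=
  [ffun j => if j == i then k else f j].

(** Kept in additive form to avoid truncated subtraction. *)
Lemma weighted_size_set_coord (P M : nat) (i : 'I_P) (k : 'I_M.+1)
    (f : {ffun 'I_P -> 'I_M.+1}) :
  (weighted_size (set_coord i k f) + i.+1 * f i = weighted_size f + i.+1 * k)%N.
Proof.
rewrite /weighted_size (bigD1 i)//= [in RHS](bigD1 i)//= ffunE eqxx.
rewrite (eq_bigr (fun j : 'I_P => (j.+1 * f j)%N)); first by lia.
by move=> j /negbTE ji; rewrite ffunE ji.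
Qed.

(** Removing one point from slice [i] is a bijection from the [f] of size [n] with [f i > 0] onto
    the vectors of size [n - i.+1], and the hypothesis on [w] trades the factor [f i] for [c i]. If
    [n <= i], a vector of size [n] has no point in slice [i]. *)
Lemma sum_coord_prod_pmf (R : comNzRingType) (P M : nat) (c : 'I_P -> R)
    (w : 'I_P -> nat -> R) (n : nat) (i : 'I_P) :
  (forall i k, k.+1%:R * w i k.+1 = c i * w i k) -> (n <= M)%N ->
  \sum_(f : {ffun 'I_P -> 'I_M.+1} | weighted_size f == n)
     (f i)%:R * prod_pmf w f =
  if (i < n)%N then
    c i * \sum_(f : {ffun 'I_P -> 'I_M.+1} | weighted_size f == (n - i.+1)%N)
            prod_pmf w f
  else 0.
Proof.
move=> wS nM; case: ifPn => [ltin|]; last first.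
  rewrite -leqNgt => leni; rewrite big1// => f /eqP fn.
  have := weighted_size_ge f i; rewrite fn => h.
  have -> : (f i : nat) = 0%N by move: h; case: (f i : nat) => // k; nia.
  by rewrite mul0r.
(* [inord] sends M.+1 to 0, so [up] adds a point only where f i < M. *)
pose up (f : {ffun 'I_P -> 'I_M.+1}) := set_coord i (inord (f i).+1) f.
pose down (f : {ffun 'I_P -> 'I_M.+1}) := set_coord i (inord (f i).-1) f.
rewrite (bigID (fun f : {ffun 'I_P -> 'I_M.+1} => (f i == 0 :> nat)))/=.
rewrite big1 ?add0r; last by move=> f /andP[_ /eqP ->]; rewrite mul0r.
rewrite (reindex_onto up down)/=; last first.
  move=> f /andP[_ fi0]; apply/ffunP => j; rewrite /up /down !ffunE eqxx.
  case: eqP => // ->; apply: val_inj => /=.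
  have fiM := ltn_ord (f i).
  by rewrite !inordK; lia.
rewrite mulr_sumr; apply: eq_big => [f|f].
  (* At [f i = M] both conditions fail: [up] resets the coordinate to 0, and size [n - i.+1] would
     require [i.+1 * M <= n - i.+1], impossible since [n <= M]. *)
  have [fiM|fiM] := ltnP (f i) M; last first.
    have -> : up f i = ord0.
      apply: val_inj; rewrite ffunE eqxx /= /inord /insubd insubN//.
      by rewrite -leqNgt; lia.
    rewrite andbF/=; apply/esym/negP => /eqP fn.
    have := weighted_size_ge f i; rewrite fn; nia.
  have -> : down (up f) == f.
    apply/eqP/ffunP => j; rewrite /up /down !ffunE eqxx.
    case: eqP => // ->; apply: val_inj => /=.
    by rewrite !inordK//; lia.
  have := weighted_size_set_coord i (inord (f i).+1) f.
  rewrite -/(up f) inordK; last by lia.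
  rewrite [up f i]ffunE eqxx inordK; last by lia.
  by rewrite andbT; case: eqP; case: eqP; rewrite //=; nia.
case/andP => /andP[_ fi0] _.
(* The reindexing condition says that [up f i] is nonzero, which rules out the overflow
   [f i = M]. *)
have fiM : ((f i).+1 < M.+1)%N.
  rewrite ltnNge; apply/negP => h; move/negP: fi0; apply; apply/eqP.
  by rewrite ffunE eqxx /= /inord /insubd insubN//= -leqNgt.
rewrite [up f i]ffunE eqxx inordK//.
rewrite /prod_pmf (bigD1 i)//= [in RHS](bigD1 i)//= ffunE eqxx inordK//.
rewrite mulrA wS mulrA; congr (_ * _); apply: eq_bigr => j /negbTE ji.
by rewrite ffunE ji.
Qed.

(** On vectors of size [n], the factor [n] is the sum of the [i.+1 * f i]; exchanging the two sums
    leaves one coordinate identity per [i]. Without division, this holds over any nonzero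
    commutative ring. *)
Lemma weighted_sum_recursion (R : comNzRingType) (P M : nat) (c : 'I_P -> R)
    (w : 'I_P -> nat -> R) (n : nat) :
  (forall i k, k.+1%:R * w i k.+1 = c i * w i k) -> (n <= M)%N ->
  n%:R * \sum_(f : {ffun 'I_P -> 'I_M.+1} | weighted_size f == n)
           prod_pmf w f =
  \sum_(i < P | (i < n)%N)
    i.+1%:R * c i *
    \sum_(f : {ffun 'I_P -> 'I_M.+1} | weighted_size f == (n - i.+1)%N)
      prod_pmf w f.
Proof.
move=> wS nM; rewrite mulr_sumr.
transitivity (\sum_(f : {ffun 'I_P -> 'I_M.+1} | weighted_size f == n)
    \sum_(i < P) i.+1%:R * ((f i)%:R * prod_pmf w f)).
  apply: eq_bigr => f /eqP fn; rewrite -{1}fn /weighted_size natr_sum mulr_suml.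
  by apply: eq_bigr => i _; rewrite natrM mulrA.
rewrite exchange_big big_mkcond/= [RHS]big_mkcond; apply: eq_bigr => i _.
rewrite -mulr_sumr (sum_coord_prod_pmf i wS nM).
by case: ifP => _; rewrite ?mulr0// mulrA.
Qed.

(** * Weights and mean of the Poisson law *)

(* This includes r = 0, where [poisson_prob] is a Dirac mass by convention:
   0 ^+ 0 = 1. *)
Lemma poisson_prob1 (R : realType) (r : R) (k : nat) : 0 <= r ->
  poisson_prob r 0 [set k] = (r ^+ k / k`!%:R * expR (- r))%:E.
Proof.
move=> r0; rewrite /poisson_prob; case: ifPn => [rpos|].
  by rewrite esum_set1 ?lee_fin ?poisson_pmf_ge0// /poisson_pmf rpos.
rewrite -leNgt => r0'; have -> : r = 0 by apply/le_anti/andP.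
rewrite diracE oppr0 expR0 mulr1 expr0n; congr (_%:E).
case: k => [|k] /=; first by rewrite fact0 divr1 mem_set.
by rewrite mul0r memNset.
Qed.

Lemma poisson_weightS (R : realType) (r : R) (k : nat) :
  k.+1%:R * (r ^+ k.+1 / k.+1`!%:R * expR (- r)) =
  r * (r ^+ k / k`!%:R * expR (- r)).
Proof.
rewrite factS natrM exprS; field.
by rewrite pnatr_eq0 -lt0n fact_gt0 nat1r pnatr_eq0.
Qed.

(** The term at 0 vanishes, and the weight identity turns the shifted series into [r] times the
    total mass, which is 1. *)
Lemma poisson_mean (R : realType) (r : R) : 0 <= r ->
  (\sum_(0 <= k <oo) (k%:R%:E * poisson_prob r 0 [set k]) = r%:E)%E.
Proof.
move=> r0.
have g0 k : (0 <= k%:R%:E * poisson_prob r 0 [set k])%E.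
  by rewrite mule_ge0// lee_fin.
rewrite (nneseries_split 0 1)// big_nat1 mul0e add0e.
rewrite -(nneseries_addn 1)//.
under eq_eseriesr.
  move=> k _; rewrite addn1 poisson_prob1// -EFinM poisson_weightS EFinM.
  rewrite -poisson_prob1//; over.
rewrite nneseriesZl//=.
rewrite (eq_eseriesl (Q := fun k => k \in [set: nat])); last first.
  by move=> k; rewrite in_setT.
rewrite -(@measure_bigcup _ _ _ (poisson_prob r 0) setT set1)//; last first.
  apply/trivIsetP => i j _ _ ij; apply/disjoints_subset => x /= ->.
  exact/eqP.
rewrite (_ : \bigcup_k [set k] = setT); last first.
  by apply/seteqP; split => // k _; exists k.
by rewrite [X in (_ * X)%E](@probability_setT _ _ _ (poisson_prob r 0)) mule1.

Qed.

Lemma expectation_poisson (R : realType) (d : measure_display)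
    (T : measurableType d) (Pr : probability T R) (r : R) (X : T -> nat) :
  0 <= r -> measurable_fun setT X ->
  (forall k, Pr (X @^-1` [set k]) = poisson_prob r 0 [set k]) ->
  ('E_Pr[fun w => (X w)%:R] = r%:E)%E.
Proof.
move=> r0 mX XE; rewrite unlock.
have mXk k : measurable (X @^-1` [set k]).
  by rewrite -[X in measurable X]setTI; exact: mX.
(* The integral is split along the level sets of [X], on which the integrand is constant. *)
rewrite (_ : setT = \bigcup_k X @^-1` [set k]); last first.
  by apply/seteqP; split => // w _; exists (X w).
rewrite ge0_integral_bigcup//; last 2 first.
- apply/measurable_EFinP; apply: measurable_funTS.
  exact: measurableT_comp mX.
- exact: trivIset_preimage1.
rewrite -[RHS]poisson_mean//; apply: eq_eseriesr => k _.
rewrite (eq_integral (cst k%:R%:E)); last by move=> w /set_mem /= ->.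
by rewrite integral_cst//; congr (_ * _)%E; exact: XE.
Qed.

(** * Rounded powers and unit slices *)

Lemma sum_ceilE (R : realType) (P : nat) (s : seq R) :
  (forall p, p \in s -> 0 <= p <= P%:R) ->
  \sum_(p <- s) Num.ceil p =
  (\sum_(i < P) i.+1 *
     count (fun p : R => p \in `](i : nat)%:R, i.+1%:R]%classic) s)%N%:Z.
Proof.
elim: s => [|p s IH] sP.
  by rewrite big_nil big1// => i _; rewrite muln0.
rewrite big_cons IH; last by move=> x xs; rewrite sP// inE xs orbT.
rewrite [in RHS](eq_bigr (fun i : 'I_P =>
    (i.+1 * (p \in `](i : nat)%:R, i.+1%:R]%classic) + i.+1 * count
      (fun p : R => p \in `](i : nat)%:R, i.+1%:R]%classic) s)%N)); last first.
  by move=> i _; rewrite -mulnDr.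
rewrite [in RHS]big_split PoszD; congr (_ + _).
have /andP[p0 pP] : 0 <= p <= P%:R by rewrite sP// mem_head.
have c0 : 0 <= Num.ceil p by rewrite -(ceil0 R) le_ceil.
have cP : Num.ceil p <= P%:Z by rewrite ceil_le_int.
have inE' (i : nat) :
    (p \in `]i%:R, i.+1%:R]%classic) = (Num.ceil p == i.+1%:Z).
  rewrite mem_setE in_itv/= eq_le ceil_le_int andbC; congr andb.
  by rewrite -[RHS]/(1%Z + i%:Z <= _) addrC lezD1 ceil_gt_int.
(* A point of ceiling 0 lies in no slice. A point of ceiling [k.+1] lies in slice [k] only, and [kP]
   makes [k] a valid index. *)
case: (Num.ceil p) c0 cP inE' => // -[|k] _ kP inE'.
  by rewrite big1// => i _; rewrite inE' /= muln0.
rewrite (bigD1 (Ordinal kP))//= inE' eqxx muln1 big1 ?addn0// => i ik.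
rewrite inE'; case: eqP => [[ki]|]; last by rewrite muln0.
by move/eqP: ik => []; apply: val_inj.
Qed.

(** * Law of the total power of the Poisson process *)

Section poisson_process_on_segment.
Context {R : realType} {d : measure_display} {T : measurableType d}.
Context {Pr : probability T R} {P : nat} {Phi : T -> seq R}.
Context {mu : {measure set (measurableTypeR R) -> \bar R}} {Lambda : R -> R}.
Context (Phi_poisson : poisson_process Pr `[0, P%:R] mu Phi).

Lemma fin_num_poisson_intensity (B : set R) : measurable B ->
  B `<=` `[0, P%:R] -> mu B \is a fin_num.
Proof.
case: Phi_poisson => _ muE _ _ mB BE.
rewrite ge0_fin_numE//; apply: le_lt_trans muE.
apply: (@le_measure _ _ _ mu) => //; rewrite inE//.
Qed.

(** This links [Lambda], given through mean counts, to [mu], which parametrizes the Poisson laws. *)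
Lemma mean_npoints_poisson (B : set R) : measurable B -> B `<=` `[0, P%:R] ->
  mean_npoints Pr Phi B = mu B.
Proof.
case: (Phi_poisson) => -[_ mPhi] _ law _ mB BE.
rewrite -[RHS](fineK (fin_num_poisson_intensity mB BE)).
apply: expectation_poisson; first by rewrite fine_ge0.
  exact: mPhi.
by move=> k; exact: law.
Qed.

Context (Lambda_mean : forall p : R, 0 <= p <= P%:R ->
  mean_npoints Pr Phi `[0, p] = (Lambda p)%:E).

Lemma poisson_intensity_itv (a b : R) : 0 <= a -> a <= b -> b <= P%:R ->
  mu `]a, b]%classic = (Lambda b - Lambda a)%:E.
Proof.
move=> a0 ab bP.
have muL p : 0 <= p -> p <= P%:R -> mu `[0, p]%classic = (Lambda p)%:E.
  move=> p0 pP; rewrite -mean_npoints_poisson//.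
    by apply: Lambda_mean; rewrite p0.
  by apply: subset_itvl; rewrite bnd_simp.
have : (mu `[0%R, b]%classic = mu `[0%R, a]%classic + mu `]a, b]%classic)%E.
  rewrite -measureU//.
  - by rewrite -itv_bndbnd_setU// bnd_simp.
  - apply/seteqP; split => // x [] /=.
    rewrite !in_itv/= => /andP[_ xa] /andP[ax _].
    by move: (lt_le_trans ax xa); rewrite ltxx.
rewrite muL//; last exact: le_trans ab.
rewrite muL//; last exact: le_trans bP.
(* Finiteness allows the additivity identity to be solved for this term in [\bar R]. *)
have : mu `]a, b]%classic \is a fin_num.
  apply: fin_num_poisson_intensity => // x /=.
  rewrite !in_itv/= => /andP[ax xb].
  by rewrite (le_trans xb)// (le_trans a0)// ltW.
case: (mu _) => [r| |] // _ /eqP; rewrite -EFinD eqe => /eqP ->.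
by rewrite addrC addKr.
Qed.

Let slice (i : nat) : set R := `]i%:R, i.+1%:R]%classic.

Let slice_subset (i : 'I_P) : slice i `<=` `[0, P%:R].
Proof.
move=> x; rewrite /slice /= !in_itv/= => /andP[ix xi].
by rewrite (le_trans _ (ltW ix))// (le_trans xi)// ler_nat.
Qed.

Let trivIset_slice : trivIset setT (fun i : 'I_P => slice i).
Proof.
apply/trivIsetP => i j _ _ ij; apply/disjoints_subset => x /=.
rewrite /slice /= !in_itv/= => /andP[ix xi] /andP[jx xj].
move: (lt_le_trans ix xj) (lt_le_trans jx xi).
rewrite !ltr_nat !ltnS => ij' ji'.
by move/eqP: ij; apply; apply/val_inj/eqP; rewrite eqn_leq ij' ji'.
Qed.

Let rate (i : nat) : R := Lambda i.+1%:R - Lambda i%:R.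

Let pmf (i : 'I_P) (k : nat) : R := rate i ^+ k / k`!%:R * expR (- rate i).

Let law_slice (i : 'I_P) (k : nat) :
  Pr (npoints Phi (slice i) @^-1` [set k]) = (pmf i k)%:E.
Proof.
case: (Phi_poisson) => _ _ law _.
rewrite law; [|exact: measurable_itv|exact: slice_subset].
have muE : mu (slice i) = (rate i)%:E.
  by apply: poisson_intensity_itv; rewrite ?ler_nat.
(* The rate is nonnegative because it is a value of the measure [mu]. *)
by rewrite muE /= poisson_prob1// -lee_fin -muE.
Qed.

(** The event is the finite disjoint union, over vectors [f] of size [n], of the events that the
    slice counts equal [f]; independence makes each probability a product. Leaving [M] free lets
    several values of [n] share one index type. *)
Lemma total_power_probE (M n : nat) : (n <= M)%N ->
  total_power_prob Pr Phi n =
  (\sum_(f : {ffun 'I_P -> 'I_M.+1} | weighted_size f == n) prod_pmf pmf f)%:E.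
Proof.
move=> nM; case: (Phi_poisson) => -[PhiE mPhi] _ _ indep.
pose N (i : 'I_P) := npoints Phi (slice i).
pose F (f : {ffun 'I_P -> 'I_M.+1}) :=
  \bigcap_(i in [set: 'I_P]) N i @^-1` [set (f i : nat)].
have mF f : measurable (F f).
  apply: fin_bigcap_measurable => // i _.
  rewrite -[X in measurable X]setTI; apply: mPhi => //.
  exact: measurable_itv.
have PF f : Pr (F f) = (prod_pmf pmf f)%:E.
  rewrite /F (indep _ _ _ slice_subset trivIset_slice); last first.
    by move=> i; exact: measurable_itv.
  rewrite /prod_pmf -prodEFin; apply: eq_bigr => i _; exact: law_slice.
pose r := [seq f <- index_enum {ffun 'I_P -> 'I_M.+1} | weighted_size f == n].
have powerE w : \sum_(p <- Phi w) Num.ceil p = (\sum_(i < P) i.+1 * N i w)%N%:Z.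
  by apply: sum_ceilE => p /PhiE; rewrite /= in_itv.
rewrite /total_power_prob.
rewrite (_ : [set w | _] = \bigcup_(f in [set` r]) F f); last first.
  apply/seteqP; split => w /=.
    rewrite powerE => -[Nn].
    (* Each count is at most the total power [n], hence at most [M]. *)
    have NM i : (N i w < M.+1)%N.
      by move: Nn; rewrite (bigD1 i)//=; nia.
    exists [ffun i => Ordinal (NM i)] => /=.
      rewrite mem_filter mem_index_enum andbT /weighted_size -[X in _ == X]Nn.
      by apply/eqP; apply: eq_bigr => i _; rewrite ffunE.
    by move=> i _; rewrite /= ffunE.
  move=> [f /=]; rewrite mem_filter => /andP[/eqP <- _] Ff.
  rewrite powerE; congr Posz; apply: eq_bigr => i _.
  by rewrite (Ff i).
rewrite measure_fin_bigcup//; last first.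
  move=> f g _ _ [w [Ff Fg]]; apply/ffunP => i; apply: val_inj.
  by rewrite /= -(Ff i)// -(Fg i).
rewrite -fsbig_seq ?filter_uniq ?index_enum_uniq// big_filter -sumEFin.
by apply: eq_bigr => f _; exact: PF.
Qed.

Lemma total_power_prob0 : Lambda 0 = 0 ->
  total_power_prob Pr Phi 0 = (expR (- Lambda P%:R))%:E.
Proof.
(* With [M = 0] the zero vector is the only index, and the exponents of its weights telescope. *)
move=> Lambda0; rewrite (@total_power_probE 0)//; congr EFin.
rewrite (bigD1 [ffun=> ord0])/=; last first.
  by apply/eqP; rewrite /weighted_size big1// => i _; rewrite ffunE muln0.
rewrite big1 ?addr0; last first.
  move=> f /andP[_ /eqP[]]; apply/ffunP => i; rewrite ffunE.
  exact: ord1.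
rewrite /prod_pmf (eq_bigr (fun i : 'I_P => expR (- rate i))); last first.
  by move=> i _; rewrite ffunE /pmf expr0 fact0 divr1 mul1r.
rewrite -expR_sum sumrN; congr (expR (- _)).
rewrite -(big_mkord xpredT rate) telescope_sumr// Lambda0 subr0.
by [].
Qed.

Lemma total_power_prob_recursion (m : nat) : (0 < m)%N ->
  total_power_prob Pr Phi m =
  (\sum_(1 <= q < (minn m P).+1)
     ((q%:R / m%:R * (Lambda q%:R - Lambda (q.-1)%:R))%:E
      * total_power_prob Pr Phi (m - q)%N))%E.
Proof.
(* The bound [M = m] serves all the sizes [m - q] at once. *)
move=> m0; pose W n :=
  \sum_(f : {ffun 'I_P -> 'I_m.+1} | weighted_size f == n) prod_pmf pmf f.
have WE n : (n <= m)%N -> total_power_prob Pr Phi n = (W n)%:E.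
  exact: total_power_probE.
have := @weighted_sum_recursion _ P m (fun i => rate i) pmf m
  (fun i k => poisson_weightS (rate i) k) (leqnn m).
rewrite -/(W m) => WS.
have m_neq0 : m%:R != 0 :> R by rewrite pnatr_eq0 -lt0n.
rewrite WE// big_add1/= big_mkord.
under eq_bigr => i _ do rewrite WE ?leq_subr// -EFinM.
rewrite sumEFin; congr EFin; apply: (mulfI m_neq0); rewrite WS mulr_sumr.
(* With [q = i.+1], both sums become sums over naturals below [P], where the condition [i < m]
   matches the upper limit [minn m P]. *)
rewrite -(big_mkord (fun i => (i < m)%N)
  (fun i => i.+1%:R * rate i * W (m - i.+1)%N)).
rewrite -(big_mkord xpredT (fun i =>
  m%:R * (i.+1%:R / m%:R * (Lambda i.+1%:R - Lambda i%:R) * W (m - i.+1)%N))).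
rewrite [RHS](big_nat_widen 0 _ P) ?geq_minr//= big_nat_cond [RHS]big_nat_cond.
apply: eq_big => [i|i _]; last by rewrite /rate; field.
by rewrite leq_min; case: (i < P)%N; rewrite ?andbT ?andbF.
Qed.

End poisson_process_on_segment.

Theorem theorem1 (R : realType) (d : measure_display) (T : measurableType d)
    (Pr : probability T R) (P : nat) (Phi : T -> seq R)
    (mu : {measure set (measurableTypeR R) -> \bar R}) (Lambda : R -> R)
    (P_gt0 : (0 < P)%N)
    (Phi_poisson : poisson_process Pr `[0, P%:R] mu Phi)
    (Lambda_mean : forall p : R, 0 <= p <= P%:R ->
      mean_npoints Pr Phi `[0, p] = (Lambda p)%:E)
    (Lambda0 : Lambda 0 = 0) :
  total_power_prob Pr Phi 0 = (expR (- Lambda P%:R))%:E /\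
  forall m : nat, (1 <= m)%N ->
    total_power_prob Pr Phi m =
    (\sum_(1 <= q < (minn m P).+1)
       ((q%:R / m%:R * (Lambda q%:R - Lambda (q.-1)%:R))%:E
        * total_power_prob Pr Phi (m - q)%N))%E.
Proof.
split; first exact: (total_power_prob0 Phi_poisson).
exact: (total_power_prob_recursion Phi_poisson).
Qed.
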